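(* Let $\mu$ be a fuzzy measure on $X=[n]$ with cardinality index $(C_0,\ldots,C_{n-1})$. If the weight function $w$ defining the index $I$ is symmetric, then for every $k\in\{0,1,\ldots,n-1\}$, $$C_k=I(\mu,n-k)=I(\mu^d,k+1).$$
   Context: Let $n\geqslant 1$ and $[n]=\{1,\ldots,n\}$. Functions $f\colon\{0,1\}^n\to\mathbb{R}$ are identified with set functions $f\colon 2^{[n]}\to\mathbb{R}$ via $f(S)=f(\mathbf{1}_S)$, where $\mathbf{1}_S$ is the indicator vector of $S$. A fuzzy measure on $X=[n]$ is a nondecreasing set function $\mu\colon 2^X\to[0,1]$ with $\mu(\varnothing)=0$ and $\mu(X)=1$. Its cardinality index is the $n$-tuple $(C_0,\ldots,C_{n-1})$ with $$C_k=\frac{1}{(n-k)\binom{n}{k}}\sum_{|S|=k}\ \sum_{x\notin S}\big(\mu(S\cup\{x\})-\mu(S)\big),$$ where $S$ ranges over subsets of $X$. Let $w\colon\{0,1\}^n\to\left]0,\infty\right[$ be a weight function, normalized so that $\sum_{\mathbf{x}}w(\mathbf{x})=1$; it is symmetric if it is invariant under all permutations of its variables. With $|\mathbf{x}|=\sum_i x_i$, for $s\in\{0,1,\ldots,n\}$ define $\overline{f}(s)=\dfrac{\sum_{|\mathbf{x}|=s}w(\mathbf{x})f(\mathbf{x})}{\sum_{|\mathbf{x}|=s}w(\mathbf{x})}$. The influence index is $I(f,j)=\overline{f}(n-j+1)-\overline{f}(n-j)$ for $j\in[n]$. The dual of $f$ is $f^d(\mathbf{x})=f(\mathbf{0})+f(\mathbf{1})-f(\mathbf{1}-\mathbf{x})$,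 where $\mathbf{0}=(0,\ldots,0)$, $\mathbf{1}=(1,\ldots,1)$; in set notation $f^d(S)=f(\varnothing)+f([n])-f([n]\setminus S)$. *)

(* Defs.v *)
From mathcomp Require Import all_boot all_order all_algebra perm reals.

Set Implicit Arguments.
Unset Strict Implicit.
Unset Printing Implicit Defensive.

Import Order.TTheory GRing.Theory Num.Theory.
Local Open Scope ring_scope.

(* The ground set [n] = {1, ..., n} is encoded as 'I_n = {0, ..., n - 1}. *)

Definition cube (n : nat) := {ffun 'I_n -> bool}.

Definition indicator n (S : {set 'I_n}) : cube n := [ffun i => i \in S].

(* The function on the cube identified with the set function f: it is
   determined by f(1_S) = f(S), see pseudo_booleanE. *)
Definition pseudo_boolean (R : realType) n (f : {set 'I_n} -> R) :
    cube n -> R :=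
  fun x => f [set i | x i].

Lemma pseudo_booleanE (R : realType) n (f : {set 'I_n} -> R) (S : {set 'I_n}) :
  pseudo_boolean f (indicator S) = f S.
Proof. by congr (f _); apply/setP => i; rewrite inE ffunE. Qed.

Record fuzzy_measure (R : realType) n (mu : {set 'I_n} -> R) : Prop := {
  fuzzy_range : forall S, 0 <= mu S <= 1;
  fuzzy_nondecreasing : forall S T : {set 'I_n}, S \subset T -> mu S <= mu T;
  fuzzy_set0 : mu set0 = 0;
  fuzzy_setT : mu [set: 'I_n] = 1
}.

Definition cardinality_index (R : realType) n (mu : {set 'I_n} -> R)
    (k : 'I_n) : R :=
  ((n - k)%:R * 'C(n, k)%:R)^-1 *
  \sum_(S : {set 'I_n} | #|S| == k) \sum_(x | x \notin S)
    (mu (x |: S) - mu S).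

Record weight_function (R : realType) n (w : cube n -> R) : Prop := {
  weight_gt0 : forall x, 0 < w x;
  weight_sum1 : \sum_x w x = 1
}.

Definition symmetric_weight (R : realType) n (w : cube n -> R) : Prop :=
  forall (s : {perm 'I_n}) (x : cube n), w [ffun i => x (s i)] = w x.

Definition cube_size n (x : cube n) : nat := (\sum_i x i)%N.

(* Meaningful for s <= n only; beyond that both sums are empty. *)
Definition level_mean (R : realType) n (w f : cube n -> R) (s : nat) : R :=
  (\sum_(x : cube n | cube_size x == s) w x * f x) /
  (\sum_(x : cube n | cube_size x == s) w x).

(* Meaningful for 1 <= j <= n only, where the truncated subtraction is exact. *)
Definition influence_index (R : realType) n (w f : cube n -> R) (j : nat) : R :=
  level_mean w f (n - j + 1) - level_mean w f (n - j).

Definition dual (R : realType) n (f : cube n -> R) : cube n -> R :=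
  fun x => f [ffun=> false] + f [ffun=> true] - f [ffun i => ~~ x i].

(* Main.v *)
Require Import Defs.
From mathcomp Require Import all_boot all_order all_algebra perm reals.
Local Open Scope ring_scope.

Import GRing.Theory Num.Theory.

(** Permutations act transitively on each level of the cube, so a symmetric
    weight is constant there and cancels: the weighted mean of [f] on the level
    [s] is the plain average of [f] over the sets of cardinality [s]
    ([level_mean_symmetric]).  Both equalities then compare plain averages.

    For the first one, each set [T] of cardinality [k + 1] arises as
    [x |: S] with [#|S| = k] in exactly [k + 1] ways, and each [S] of
    cardinality [k] has [n - k] points outside it ([sum_setU1_level]).  Since
    [(n - k) 'C(n, k) = (k + 1) 'C(n, k + 1)], the normalization in the
    cardinality index turns both parts of the double sum into level averages.

    For the second one, complementation exchanges the levels [s] and [n - s], so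
    the means of the dual are those of [f], reflected and negated up to an
    additive constant ([level_mean_dual]); the difference of consecutive means is
    thus the same when read from the other end. *)

Lemma cube_size_indicator n (S : {set 'I_n}) : cube_size (indicator S) = #|S|.
Proof.
rewrite /cube_size -sum1_card [RHS]big_mkcond /=.
by apply: eq_bigr => i _; rewrite ffunE; case: (i \in S).
Qed.

Lemma sum_cube_level (R : realType) n (f : cube n -> R) (s : nat) :
  \sum_(x : cube n | cube_size x == s) f x =
  \sum_(S : {set 'I_n} | #|S| == s) f (indicator S).
Proof.
have indicatorK : cancel (@indicator n) (fun x : cube n => [set i | x i]).
  by move=> S; apply/setP => i; rewrite inE ffunE.
have setK : cancel (fun x : cube n => [set i | x i]) (@indicator n).
  by move=> x; apply/ffunP => i; rewrite ffunE inE.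
rewrite (reindex (@indicator n)) /=; last first.
  by exists (fun x : cube n => [set i | x i]) => z _; [apply: indicatorK | apply: setK].
by apply: eq_bigl => S; rewrite cube_size_indicator.
Qed.

Lemma card_level n (s : nat) :
  (\sum_(S : {set 'I_n} | #|S| == s) 1)%N = 'C(n, s).
Proof.
rewrite sum1_card -[in RHS](card_ord n) -(card_draws 'I_n s).
by apply: eq_card => S; rewrite !inE.
Qed.

(** The value lists of [x] and [y] contain as many [true], and as many [false],
    hence one list is a rearrangement of the other. *)
Lemma cube_size_perm n (x y : cube n) : cube_size x = cube_size y ->
  exists p : {perm 'I_n}, x = [ffun i => y (p i)].
Proof.
move=> sxy.
have count_size (z : cube n) : count_mem true [tuple z i | i < n] = cube_size z.
  rewrite -sum1_count /cube_size big_map big_enum_cond /= big_mkcond /=.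
  by apply: eq_bigr => i _; case: (z i).
have count_both (t : n.-tuple bool) :
    (count_mem true t + count_mem false t = n)%N.
  rewrite -[RHS](size_tuple t) -(count_predC (pred1 true) t); congr (_ + _)%N.
  by apply: eq_count => -[].
have /tuple_permP[p xp] : perm_eq [tuple x i | i < n] [tuple y i | i < n].
  have eqT : count_mem true [tuple x i | i < n] =
             count_mem true [tuple y i | i < n] by rewrite !count_size.
  apply/allP => -[] _ /=; apply/eqP => //.
  apply/eqP; rewrite -(eqn_add2l (count_mem true [tuple x i | i < n])).
  by rewrite count_both eqT count_both.
exists p; apply/ffunP => i; rewrite ffunE.
have /val_inj/(congr1 (fun t => tnth t i)) := xp.
by rewrite !tnth_mktuple.
Qed.

Lemma level_mean_symmetric (R : realType) n (w f : cube n -> R) (s : nat) :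
  weight_function w -> symmetric_weight w ->
  level_mean w f s =
  'C(n, s)%:R^-1 * \sum_(S : {set 'I_n} | #|S| == s) f (indicator S).
Proof.
move=> hw hsym; rewrite /level_mean.
case: (pickP (fun x : cube n => cube_size x == s)) => [x0 /eqP sx0 | none].
  have w_cst x : cube_size x == s -> w x = w x0.
    move=> /eqP sx; have [|p ->] := @cube_size_perm n x x0; first by rewrite sx.
    exact: hsym.
  have w0 : w x0 != 0 by rewrite lt0r_neq0 ?(weight_gt0 hw).
  rewrite (eq_bigr (fun x => w x0 * f x)) => [|x /w_cst -> //].
  rewrite [X in _ / X](eq_bigr (fun=> w x0 * 1)) => [|x /w_cst ->]; last first.
    by rewrite mulr1.
  rewrite -!mulr_sumr -mulf_div divff // mul1r mulrC !sum_cube_level.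
  by rewrite -(card_level n s) natr_sum.
(* No level beyond [n]: both sides are empty sums. *)
by rewrite -sum_cube_level !(big_pred0 _ _ _ _ none) mul0r mulr0.
Qed.

(** The inner sum over [S] is reindexed, for each fixed [x], by the bijection
    [S |-> x |: S] onto the sets containing [x]; a set [T] of cardinality
    [k + 1] is then counted once for each of its elements. *)
Lemma sum_setU1_level (V : nmodType) (T : finType) (g : {set T} -> V) (k : nat) :
  \sum_(S : {set T} | #|S| == k) \sum_(x | x \notin S) g (x |: S) =
  (\sum_(S : {set T} | #|S| == k.+1) g S) *+ k.+1.
Proof.
rewrite (exchange_big_dep xpredT) //=.
transitivity (\sum_(x : T) \sum_(S : {set T} | (#|S| == k.+1) && (x \in S)) g S).
  apply: eq_bigr => x _.
  rewrite [RHS](reindex_onto (fun S => x |: S) (fun S => S :\ x)) /=; last first.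
    by move=> S /andP[_ xS]; rewrite setD1K.
  apply: eq_bigl => S; rewrite setU11 andbT cardsU1.
  have [xS | xS] := boolP (x \in S); last by rewrite add1n eqSS setU1K // eqxx.
  rewrite andbF; apply/esym/negP => /andP[_ /eqP eS].
  by move: xS; rewrite -eS !inE eqxx.
rewrite (exchange_big_dep (fun S : {set T} => #|S| == k.+1)) /=; last first.
  by move=> x S _ /andP[].
rewrite -sumrMnl; apply: eq_bigr => S /eqP cS.
rewrite (eq_bigl (fun x => x \in S)) => [|x]; last by rewrite cS eqxx.
by rewrite sumr_const cS.
Qed.

Lemma cardinality_index_averages (R : realType) n (mu : {set 'I_n} -> R)
    (k : 'I_n) :
  cardinality_index mu k =
    'C(n, k.+1)%:R^-1 * \sum_(S : {set 'I_n} | #|S| == k.+1) mu S -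
    'C(n, k)%:R^-1 * \sum_(S : {set 'I_n} | #|S| == k) mu S.
Proof.
have kn := ltn_ord k.
rewrite /cardinality_index.
under eq_bigr do rewrite sumrB.
rewrite sumrB sum_setU1_level mulrBr; congr (_ - _).
  rewrite -[X in _ * X = _]mulr_natl mulrA; congr (_ * _).
  rewrite -natrM -mul_bin_left natrM invfM mulrAC mulVf ?mul1r //.
  by rewrite pnatr_eq0.
rewrite (eq_bigr (fun S => (n - k)%:R * mu S)) => [|S /eqP cS]; last first.
  rewrite sumr_const -[LHS]mulr_natl; congr (_%:R * _).
  have := congr1 (subn^~ (nat_of_ord k)) (cardC (mem S)).
  by rewrite /= card_ord cS addKn.
rewrite -mulr_sumr mulrA; congr (_ * _).
by rewrite invfM mulrAC mulVf ?mul1r // pnatr_eq0 subn_eq0 -ltnNge.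
Qed.

Lemma level_mean_dual (R : realType) n (w f : cube n -> R) (s : nat) :
  weight_function w -> symmetric_weight w -> (s <= n)%N ->
  level_mean w (dual f) s =
  f [ffun=> false] + f [ffun=> true] - level_mean w f (n - s).
Proof.
move=> hw hsym sn; rewrite !level_mean_symmetric // bin_sub //.
have C0 : 'C(n, s)%:R != 0 :> R by rewrite pnatr_eq0 -lt0n bin_gt0.
rewrite /dual sumrB mulrBr; congr (_ - _).
  rewrite (eq_bigr (fun=> (f [ffun=> false] + f [ffun=> true]) * 1%:R)) => [|S _].
    by rewrite -mulr_sumr -natr_sum card_level mulrC mulfK.
  by rewrite mulr1.
congr (_ * _); rewrite [RHS](reindex_inj (@setC_inj _)) /=.
apply: eq_big => [S | S _].
  have Sn : (#|S| <= n)%N by have := max_card (mem S); rewrite card_ord.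
  by rewrite [in RHS]cardsCs setCK card_ord eqn_sub2lE.
by congr (f _); apply/ffunP => i; rewrite !ffunE inE.
Qed.

Theorem mainTheorem9 (R : realType) (n : nat) (hn : (1 <= n)%N)
    (mu : {set 'I_n} -> R) (hmu : fuzzy_measure mu)
    (w : cube n -> R) (hw : weight_function w) (hsym : symmetric_weight w)
    (k : 'I_n) :
  cardinality_index mu k = influence_index w (pseudo_boolean mu) (n - k) /\
  influence_index w (pseudo_boolean mu) (n - k) =
    influence_index w (dual (pseudo_boolean mu)) (k + 1).
Proof.
have kn := ltn_ord k.
have mean_mu s : level_mean w (pseudo_boolean mu) s =
    'C(n, s)%:R^-1 * \sum_(S : {set 'I_n} | #|S| == s) mu S.
  rewrite level_mean_symmetric //; congr (_ * _).
  by apply: eq_bigr => S _; rewrite pseudo_booleanE.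
rewrite /influence_index subKn ?(ltnW kn) // addn1; split.
  by rewrite !mean_mu cardinality_index_averages.
rewrite !addn1 subnSK // !level_mean_dual ?leq_subr // !subKn ?(ltnW kn) //.
by rewrite opprB [RHS]addrC addrA subrK.
Qed.
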